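(* Let $G$ be a countable group satisfying property RD with respect to a length function $L$ and polynomial $P$. Then for every $r>0$ and every two finite subsets $S,X\subseteq G$ such that every element of $S$ has length at most $r$ (with respect to $L$), we have $$|SX|\ge\frac{|S|\,|X|}{P(r)}.$$
   Context: $SX=\{sx: s\in S,\ x\in X\}$. All polynomials are assumed to have non-negative coefficients. A length function is a map $L\colon G\to[0,\infty)$ with $L(gh)\le L(g)+L(h)$, $L(g)=L(g^{-1})$, $L(1)=0$. Property RD: for finitely supported $\phi,\psi\colon G\to[0,\infty)$ put $\|\phi\|=\sqrt{\sum_{g}\phi(g)^2}$, $\phi*\psi(k)=\sum_{g}\phi(g)\psi(g^{-1}k)$, $\mathrm{prop}(\phi)=\max\{L(g): \phi(g)\ne 0\}$. $G$ satisfies property RD with respect to $L$ and polynomial $P$ if for every $r>0$ and all finitely supported $\phi,\psi\colon G\to[0,\infty)$ with $\mathrm{prop}(\phi)\le r$ one has $\|\phi*\psi\|^2\le P(r)\|\phi\|^2\|\psi\|^2$. *)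

(* Defs.v *)
From HB Require Import structures.
From mathcomp Require Import all_boot all_order all_algebra finmap.
From mathcomp Require Import boolp classical_sets functions cardinality reals.

Set Implicit Arguments.
Unset Strict Implicit.
Unset Printing Implicit Defensive.
Import Order.TTheory GRing.Theory Num.Theory.
Local Open Scope fset_scope.
Local Open Scope ring_scope.

Definition product_set (G : groupType) (S X : {fset G}) : {fset G} :=
  [fset (s * x)%g | s in S, x in X].

Record length_function (R : realType) (G : groupType) (L : G -> R) : Prop := {
  length_ge0 : forall g, 0 <= L g;
  length_mul : forall g h, L (g * h)%g <= L g + L h;
  length_inv : forall g, L g = L g^-1%g;
  length_one : L 1%g = 0
}.

Section FinitelySupported.
Context (R : realType) (G : groupType).
Implicit Types phi psi : {fsfun G -> R with 0}.

Definition l2norm phi : R := Num.sqrt (\sum_(g <- finsupp phi) phi g ^+ 2).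

(* The sum vanishes for k outside the product of the two supports, so the
   formula holds for every k : G; see convE. *)
Definition conv phi psi : {fsfun G -> R with 0} :=
  [fsfun k in product_set (finsupp phi) (finsupp psi) =>
     \sum_(g <- finsupp phi) phi g * psi (g^-1 * k)%g | 0].

Lemma convE phi psi (k : G) :
  conv phi psi k = \sum_(g <- finsupp phi) phi g * psi (g^-1 * k)%g.
Proof.
rewrite /conv fsfun_fun; case: ifPn => // kN; apply/esym.
rewrite big_seq big1 // => g gphi.
case: (finsuppP psi (g^-1 * k)%g) => [_|gk]; first by rewrite mulr0.
case/negP: kN; rewrite -[k](mulVKg g).
exact: in_imfset2.
Qed.

(* By convention, prop 0 = 0; for phi != 0 and L a length function, starting
   the maximum at 0 is harmless since L >= 0. *)
Definition prop (L : G -> R) phi : R :=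
  \big[Num.max/0]_(g <- finsupp phi) L g.

Definition property_RD (L : G -> R) (P : {poly R}) : Prop :=
  forall (r : R) phi psi, 0 < r ->
    (forall g, 0 <= phi g) -> (forall g, 0 <= psi g) ->
    prop L phi <= r ->
    l2norm (conv phi psi) ^+ 2 <= P.[r] * l2norm phi ^+ 2 * l2norm psi ^+ 2.

End FinitelySupported.

(* Main.v *)
Require Import Defs.
From HB Require Import structures.
From mathcomp Require Import all_boot all_order all_algebra finmap.
From mathcomp Require Import boolp classical_sets functions cardinality reals.
From mathcomp Require Import lra.

Set Implicit Arguments.
Unset Strict Implicit.
Unset Printing Implicit Defensive.
Import Order.TTheory GRing.Theory Num.Theory.
Local Open Scope fset_scope.
Local Open Scope ring_scope.

(** Test property RD on the indicator functions of S and X.  The convolution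
    N = 1_S * 1_X counts the representations k = s x of each element k; it lives
    on SX and its total mass is |S||X| ([sum_conv_indicator]), so a small SX
    forces a large l2 norm.  Property RD bounds that norm from above by
    |N|^2 <= P(r) |S| |X|.

    The usual comparison of the two is the Cauchy-Schwarz inequality; here it
    suffices to expand the inequality
      0 <= sum_(k in SX) (N k - P(r))^2 = |N|^2 - 2 P(r) |S||X| + P(r)^2 |SX|,
    which with the bound on |N|^2 gives P(r) |S||X| <= P(r)^2 |SX|.
    Divide by P(r)^2; when P(r) = 0 the claim is trivial because 1/0 = 0. *)

Section Indicators.
Context (R : realType) (G : groupType).
Implicit Types (A S X : {fset G}) (phi : {fsfun G -> R with 0}).

Definition indicator A : {fsfun G -> R with 0} := [fsfun k in A => 1 | 0].

Lemma indicatorE A g : indicator A g = (g \in A)%:R.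
Proof. by rewrite fsfun_fun; case: ifP. Qed.

Lemma finsupp_indicator A : finsupp (indicator A) = A.
Proof.
apply/fsetP => g; rewrite mem_finsupp indicatorE.
by case: (g \in A); rewrite ?oner_eq0 ?eqxx.
Qed.

Lemma sum_const_fset (c : R) A : \sum_(g <- A) c = c *+ #|` A|.
Proof. by rewrite big_const_seq count_predT iter_addr_0. Qed.

Lemma sum_indicator_sub A X : A `<=` X ->
  \sum_(g <- X) indicator A g = #|` A|%:R.
Proof.
move=> AX; rewrite -(big_fset_incl _ AX) => [|g _ gA].
  rewrite big_seq (eq_bigr (fun=> 1)) => [|g gA].
    by rewrite -big_seq sum_const_fset.
  by rewrite indicatorE gA.
by rewrite indicatorE (negPf gA).
Qed.

Lemma l2norm_sqr_sub phi A : finsupp phi `<=` A ->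
  l2norm phi ^+ 2 = \sum_(g <- A) phi g ^+ 2.
Proof.
move=> phiA; rewrite /l2norm sqr_sqrtr; last by apply: sumr_ge0 => g _; exact: sqr_ge0.
apply: big_fset_incl phiA _ => g _ gphi.
by rewrite fsfun_dflt // expr0n.
Qed.

Lemma l2norm_indicator A : l2norm (indicator A) ^+ 2 = #|` A|%:R.
Proof.
rewrite (@l2norm_sqr_sub _ A) ?finsupp_indicator // -(@sum_indicator_sub A A) //.
by apply: eq_bigr => g _; rewrite indicatorE; case: (g \in A); rewrite ?expr1n ?expr0n.
Qed.

Lemma finsupp_conv_indicator S X :
  finsupp (conv (indicator S) (indicator X)) `<=` product_set S X.
Proof.
apply: fsubset_trans (finsupp_sub _ _ _) _.
by rewrite !finsupp_indicator.
Qed.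

(** Each s in S contributes |X|, because sX lies inside SX. *)
Lemma sum_conv_indicator S X :
  \sum_(k <- product_set S X) conv (indicator S) (indicator X) k
  = #|` S|%:R * #|` X|%:R.
Proof.
under eq_bigr do rewrite convE finsupp_indicator.
rewrite exchange_big /= mulr_natl -sum_const_fset.
rewrite big_seq [RHS]big_seq; apply: eq_bigr => s sS.
pose sX : {fset G} := [fset (s * x)%g | x in X].
have cardsX : #|` sX| = #|` X| by rewrite card_imfset //; exact: mulgI.
rewrite -cardsX -(@sum_indicator_sub sX (product_set S X)); last first.
  by apply/fsubsetP => _ /imfsetP[x xX ->]; exact: in_imfset2.
apply: eq_bigr => k _; rewrite !indicatorE sS mul1r; congr (_%:R).
(* Write k = s (s^-1 k): it lies in sX exactly when s^-1 k lies in X. *)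
by rewrite -[in RHS](mulVKg s k) mem_imfset //; exact: mulgI.
Qed.

Lemma prop_indicator_le (L : G -> R) r S : 0 <= r ->
  (forall s, s \in S -> L s <= r) -> prop L (indicator S) <= r.
Proof.
move=> r_ge0 Sr; rewrite /prop finsupp_indicator big_seq.
by apply: (big_ind (fun x => x <= r)) => // x y xr yr; rewrite ge_max xr.
Qed.

End Indicators.

Lemma horner_ge0 (R : numDomainType) (P : {poly R}) (r : R) :
  (forall i, 0 <= P`_i) -> 0 <= r -> 0 <= P.[r].
Proof.
move=> P_ge0 r_ge0; rewrite horner_coef; apply: sumr_ge0 => i _.
by rewrite mulr_ge0 ?exprn_ge0.
Qed.

Theorem proposition4p1 (R : realType) (G : groupType)
  (G_countable : countable [set: G]%classic)
  (L : G -> R) (L_length : length_function L)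
  (P : {poly R}) (P_ge0 : forall i : nat, 0 <= P`_i)
  (GRD : property_RD L P)
  (r : R) (r_gt0 : 0 < r)
  (S X : {fset G}) (S_le_r : forall s : G, s \in S -> L s <= r) :
  #|` product_set S X|%:R >= #|` S|%:R * #|` X|%:R / P.[r].
Proof.
set n : R := #|` product_set S X|%:R; set T : R := #|` S|%:R * #|` X|%:R.
set p := P.[r].
have p_ge0 : 0 <= p by apply: horner_ge0 => //; exact: ltW.
have [p0|p_neq0] := eqVneq p 0; first by rewrite p0 invr0 mulr0 ler0n.
have p_gt0 : 0 < p by rewrite lt_def p_neq0.
pose N := conv (indicator R S) (indicator R X).
have N_le : \sum_(k <- product_set S X) N k ^+ 2 <= p * T.
  rewrite -l2norm_sqr_sub; last exact: finsupp_conv_indicator.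
  have := GRD r (indicator R S) (indicator R X) r_gt0.
  rewrite !l2norm_indicator -mulrA; apply.
  - by move=> g; rewrite indicatorE.
  - by move=> g; rewrite indicatorE.
  - by apply: prop_indicator_le => //; exact: ltW.
have : 0 <= \sum_(k <- product_set S X) (N k - p) ^+ 2.
  by apply: sumr_ge0 => k _; exact: sqr_ge0.
under eq_bigr do rewrite sqrrB.
rewrite big_split sumrB sumrMnl -mulr_suml sum_conv_indicator -/T /=.
rewrite sum_const_fset -mulr_natr -/n => expand.
rewrite ler_pdivrMr // -(ler_pM2l p_gt0).
nra.
Qed.
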